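(* Let $M$ be a sparing monoid, and let $\varphi\colon S\to\mathbb{P}\times\mathcal{N}$ be a lifting function on $M$. Then the following statements hold. (1) An element of $M_\varphi$ satisfies the ACCP in $M_\varphi$ if and only if its $M$-projection satisfies the ACCP in $M$. (2) The lifting monoid $M_\varphi$ satisfies the ACCP if and only if $M$ satisfies the ACCP.
   Context: Notation: $\mathbb{P}$ is the set of primes, $\mathbb{N}_0$ the nonnegative integers, $v_p$ the $p$-adic valuation on $\mathbb{Q}^\times$, $\mathcal{N}$ the class of all additive submonoids of $\mathbb{N}_0$. For a monoid $M$, $M^\bullet$ is its set of nonzero elements. For elements $b,c$ of an additive monoid $H$, $c\mid_H b$ means $b=c+d$ for some $d\in H$. $\langle\cdot\rangle$ denotes the submonoid generated by a set. Sparing monoid: a nontrivial additive submonoid $M$ of $\mathbb{Q}_{\ge 0}$ such that there are infinitely many primes $p$ with $v_p(q)\ge 0$ for all $q\in M^\bullet$. Lifting function: given a nonempty subset $S\subseteq M^\bullet$ and an injective function $\pi\colon S\to\mathbb{P}$, a lifting function on $M$ is a function $\varphi\colon S\to\mathbb{P}\times\mathcal{N}$, $s\mapsto(\pi(s),N_s)$, such that (i) $v_{\pi(s)}(q)\ge 0$ and $v_{\pi(s)}(s)=0$ for all $s\in S$ and $q\in M^\bullet$; (ii) $\pi(s)\in N_s$ for all $s\in S$. It is tacitly assumed that $N_s\ne\pi(s)\mathbb{N}_0$ for all $s\in S$. Lifting monoid: for $q\in M$ put $M_q:=\frac{q}{\pi(q)}N_q$ if $q\in S$ and $M_q:=q\mathbb{N}_0$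 if $q\notin S$. Then $M_\varphi:=\langle\bigcup_{q\in M}M_q\rangle\subseteq\mathbb{Q}_{\ge 0}$, which contains $M$. Every $x\in M_\varphi$ can be written uniquely as $x=x_0+\sum_{s\in S}x_s$ (all but finitely many $x_s$ equal to $0$) with $x_0\in M$ and $x_s\in M_s$ such that $s\nmid_{M_s}x_s$ for every $s\in S$. The element $x_0$ is called the $M$-projection of $x$. ACCP: an element $b$ of a monoid $H$ satisfies the ascending chain condition on principal ideals (ACCP) in $H$ if every ascending chain of principal ideals of $H$ whose first term is $b+H$ eventually stabilizes. The monoid $H$ satisfies the ACCP if every element of $H$ does. *)

(* Defs.v *)
From mathcomp Require Import all_boot all_order all_algebra.
From mathcomp Require Import boolp classical_sets functions cardinality fsbigop.

Set Implicit Arguments.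
Unset Strict Implicit.
Unset Printing Implicit Defensive.

Import Order.TTheory GRing.Theory Num.Theory.
Local Open Scope classical_set_scope.
Local Open Scope ring_scope.

Definition is_submonoid (T : nmodType) (H : set T) : Prop :=
  H 0 /\ forall x y, H x -> H y -> H (x + y).

Definition gen_submonoid (T : nmodType) (A : set T) : set T :=
  smallest (@is_submonoid T) A.

(* [H]^bullet *)
Definition nonzero_part (T : nmodType) (H : set T) : set T :=
  [set x | H x /\ x != 0].

(* [c] divides [b] in the monoid [H] *)
Definition divides_in (T : nmodType) (H : set T) (c b : T) : Prop :=
  exists2 d, H d & b = c + d.

Definition principal_ideal (T : nmodType) (H : set T) (b : T) : set T :=
  [set b + h | h in H].

Definition is_principal_ideal (T : nmodType) (H I : set T) : Prop :=
  exists2 a, H a & I = principal_ideal H a.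

Definition satisfies_accp (T : nmodType) (H : set T) (b : T) : Prop :=
  forall I : nat -> set T,
    (forall n, is_principal_ideal H (I n)) ->
    I 0%N = principal_ideal H b ->
    (forall n, I n `<=` I n.+1) ->
    exists N, forall n, (N <= n)%N -> I n = I N.

Definition monoid_accp (T : nmodType) (H : set T) : Prop :=
  forall b, H b -> satisfies_accp H b.

(* The [p]-adic valuation of a nonzero rational, for [p] prime (the value at 0
   is the junk value 0). *)
Definition padic_val (p : nat) (q : rat) : int :=
  (logn p `|numq q|)%:Z - (logn p `|denq q|)%:Z.

Record sparing_monoid (M : set rat) : Prop := SparingMonoid {
  sparing_submonoid : is_submonoid M;
  sparing_ge0 : M `<=` [set q | 0 <= q];
  sparing_nontrivial : nonzero_part M !=set0;
  sparing_primes : infinite_set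
    [set p : nat | prime p /\ forall q, nonzero_part M q -> 0 <= padic_val p q]
}.

(* A lifting function [S -> P x N] is represented by a total function [phi] on
   [rat], of which only the values on [S] are ever used:
   [pi(s) = (phi s).1] and [N_s = (phi s).2]. *)
Record lifting_function (M S : set rat) (phi : rat -> nat * set nat) : Prop :=
  LiftingFunction {
  lifting_nonempty : S !=set0;
  lifting_sub : S `<=` nonzero_part M;
  lifting_prime : forall s, S s -> prime (phi s).1;
  lifting_inj : set_inj S (fun s => (phi s).1);
  lifting_submonoid : forall s, S s -> is_submonoid (phi s).2;
  lifting_val_ge0 : forall s q, S s -> nonzero_part M q ->
    0 <= padic_val (phi s).1 q;
  lifting_val_eq0 : forall s, S s -> padic_val (phi s).1 s = 0;
  lifting_mem : forall s, S s -> (phi s).2 (phi s).1;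
  lifting_neq : forall s, S s ->
    (phi s).2 <> [set ((phi s).1 * n)%N | n in [set: nat]]
}.

(* [M_q] *)
Definition lifting_component (S : set rat) (phi : rat -> nat * set nat)
    (q : rat) : set rat :=
  if q \in S then [set q / (phi q).1%:R * n%:R | n in (phi q).2]
  else [set q *+ n | n in [set: nat]].

(* [M_phi] *)
Definition lifting_monoid (M S : set rat) (phi : rat -> nat * set nat) :
    set rat :=
  gen_submonoid (\bigcup_(q in M) lifting_component S phi q).

(* [x = x0 + \sum_(s in S) x_s] is the canonical decomposition of [x] *)
Definition is_decomposition (M S : set rat) (phi : rat -> nat * set nat)
    (x x0 : rat) (xs : rat -> rat) : Prop :=
  [/\ M x0,
      forall s, S s -> lifting_component S phi s (xs s),
      forall s, S s -> ~ divides_in (lifting_component S phi s) s (xs s),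
      finite_set [set s | S s /\ xs s != 0]
    & x = x0 + \sum_(s \in S) xs s].

(* The first term of the canonical decomposition of [x], which exists and is
   unique for [x] in [lifting_monoid M S phi]; 0 if [x] has no such
   decomposition. *)
Definition M_projection (M S : set rat) (phi : rat -> nat * set nat)
    (x : rat) : rat :=
  xget 0 [set x0 | exists xs, is_decomposition M S phi x x0 xs].

(* Main.v *)
(** Adding two canonical decompositions can only move multiples of [s] from the
    [s]-component to the [M]-part, so a divisibility chain in the lifting monoid
    projects to a divisibility chain in [M].  Once the projections are constant
    nothing is carried any more, the components add up without interaction, and
    the sum of the numerators [n s] is a natural number that drops at every
    proper step.  Conversely the [M]-projection of [x] divides [x], and a chain
    in [M] is also a chain in the lifting monoid. *)

Require Import Defs.
From mathcomp Require Import all_boot all_order all_algebra.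
From mathcomp Require Import ring.
From mathcomp Require Import boolp classical_sets functions cardinality fsbigop.

Set Implicit Arguments.
Unset Strict Implicit.
Unset Printing Implicit Defensive.

Import Order.TTheory GRing.Theory Num.Theory.
Local Open Scope classical_set_scope.
Local Open Scope ring_scope.

(** * Stabilizing sequences and finitely supported sums *)

Lemma nonincreasing_nat_stabilizes (u : nat -> nat) N0 :
  (forall n, (N0 <= n)%N -> (u n.+1 <= u n)%N) ->
  exists2 N, (N0 <= N)%N & forall n, (N <= n)%N -> u n = u N.
Proof.
move=> decr.
have le_u i j : (N0 <= i)%N -> (i <= j)%N -> (u j <= u i)%N.
  move=> N0i; elim: j => [|j IH]; first by rewrite leqn0 => /eqP->.
  rewrite leq_eqVlt => /predU1P[->//|ij].
  by rewrite (leq_trans (decr _ _)) ?IH // (leq_trans N0i).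
have [N N0N minN] : exists2 N, (N0 <= N)%N & forall n, (N0 <= n)%N -> (u N <= u n)%N.
  have exv : exists v, `[< exists2 N, (N0 <= N)%N & u N = v >].
    by exists (u N0); apply/asboolP; exists N0.
  case: (ex_minnP exv) => v /asboolP[N N0N <-] minv.
  by exists N => // n N0n; apply: minv; apply/asboolP; exists n.
exists N => // n Nn; apply/eqP; rewrite eqn_leq le_u //= minN //.
exact: leq_trans Nn.
Qed.

(** The list [r] is chosen before [V] and [f], so that several sums with supports in [F] become sums
    over one list and can be compared termwise. *)
Lemma fsum_seq (T : choiceType) (A F : set T) : finite_set F -> F `<=` A ->
  exists r : seq T, [/\ uniq r, forall x, x \in r -> A x,
    forall x, F x -> x \in r &
    forall (V : nmodType) (f : T -> V),
      (forall x, A x -> ~ F x -> f x = 0) ->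
      \sum_(x \in A) f x = \sum_(x <- r) f x].
Proof.
move=> /finite_seqP[s ->] sA; exists (undup s).
have inF x : x \in undup s <-> [set` s] x by rewrite mem_undup.
split; [exact: undup_uniq | by move=> x /inF/sA | by move=> x /inF |].
move=> V f f0; rewrite (fsbigE (undup s)) ?undup_uniq //.
- rewrite big_seq_cond [RHS]big_seq; apply: eq_bigl => x.
  by case: (boolP (x \in undup s)) => //= /inF/sA Ax; rewrite mem_set.
- by move=> x /inF/sA.
- by move=> x Ax /negP nx; apply: f0 => // /inF.
Qed.

(** * Divisibility chains and the ACCP *)

Section Accp.
Variable H : set rat.
Hypotheses (Hm : is_submonoid H) (H_ge0 : H `<=` [set q | 0 <= q]).

Lemma sub_principal_ideal a b : H a ->
  principal_ideal H a `<=` principal_ideal H b <-> divides_in H b a.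
Proof.
move=> Ha; split=> [sub | [d Hd ->] _ [h Hh <-]].
  by have [|h Hh <-] := sub a; [exists 0; [apply Hm.1 | rewrite addr0] | exists h].
by exists (d + h); [exact: Hm.2 | rewrite addrA].
Qed.

(** Mutual divisors are at most each other because the cofactors are nonnegative. *)
Lemma principal_ideal_inj a b : H a -> H b ->
  principal_ideal H a = principal_ideal H b -> a = b.
Proof.
move=> Ha Hb eqI.
have [d Hd ab] : divides_in H b a by apply/sub_principal_ideal => //; rewrite eqI.
have [e He ba] : divides_in H a b by apply/sub_principal_ideal => //; rewrite eqI.
by apply/eqP; rewrite eq_le {1}ba ab !lerDl !H_ge0.
Qed.

(** Each principal ideal has a single generator, so a chain of ideals is the same as a chain of
    elements, each divisible by the next. *)
Lemma accpP b : H b ->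
  satisfies_accp H b <->
  forall a : nat -> rat, a 0%N = b -> (forall n, H (a n)) ->
    (forall n, divides_in H (a n.+1) (a n)) ->
    exists N, forall n, (N <= n)%N -> a n = a N.
Proof.
move=> Hb; split=> [accp a a0 Ha diva | accp I Ip I0 Ile].
  have [|||N stabN] := accp (fun n => principal_ideal H (a n)).
  - by move=> n; exists (a n).
  - by rewrite a0.
  - by move=> n; apply/sub_principal_ideal.
  by exists N => n Nn; apply: principal_ideal_inj => //; exact: stabN.
have /choice[a aP] n : exists a, H a /\ I n = principal_ideal H a.
  by have [a] := Ip n; exists a.
have [|||N stabN] := accp a.
- by apply: principal_ideal_inj => //; [apply (aP _).1 | rewrite -(aP _).2].
- by move=> n; apply (aP n).1.
- move=> n; apply/sub_principal_ideal; first by apply (aP n).1.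
  by rewrite -!(aP _).2.
by exists N => n Nn; rewrite !(aP _).2 stabN.
Qed.

(** A chain starting at [y] becomes a chain starting at [x] when [x] is put in front of it. *)
Lemma satisfies_accp_divisor x y : H x -> H y -> divides_in H y x ->
  satisfies_accp H x -> satisfies_accp H y.
Proof.
move=> Hx Hy yx /(accpP Hx) accp; apply/(accpP Hy) => a a0 Ha diva.
have [||| N stabN] := accp (fun n => if n is n'.+1 then a n' else x) => //.
- by case.
- by case=> //; rewrite a0.
by exists N => n Nn; rewrite (stabN n.+1) ?(stabN N.+1) // ltnW.
Qed.

End Accp.

(** A divisibility chain in [H] is also one in [K], and stabilization of the elements does not
    depend on the ambient monoid. *)
Lemma satisfies_accp_sub (H K : set rat) b :
  is_submonoid H -> is_submonoid K -> K `<=` [set q | 0 <= q] -> H `<=` K ->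
  H b -> satisfies_accp K b -> satisfies_accp H b.
Proof.
move=> Hm Km K_ge0 HK Hb /(accpP Km K_ge0 (HK _ Hb)) accp.
have H_ge0 := subset_trans HK K_ge0.
apply/(accpP Hm H_ge0 Hb) => a a0 Ha diva; apply: accp => // n; first exact/HK.
by have [d Hd ->] := diva n; exists d => //; exact: HK.
Qed.

(** * Rationals integral at a prime *)

(** For [p] prime this is the localization of the integers at [p]. Unlike a bound on [padic_val], it
    treats 0 uniformly and is easily seen to be closed under ring operations. *)
Definition pintegral (p : nat) (q : rat) : Prop :=
  exists2 b : nat, coprime p b & b%:R * q \is a Num.int.

Lemma pintegral_int p q : q \is a Num.int -> pintegral p q.
Proof. by exists 1%N; rewrite ?coprimen1 ?mul1r. Qed.

Lemma pintegralD p x y : pintegral p x -> pintegral p y -> pintegral p (x + y).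
Proof.
move=> [a pa ax] [b pb bay]; exists (a * b)%N; first by rewrite coprimeMr pa.
rewrite natrM mulrDr -mulrA mulrCA -[a%:R * b%:R * y]mulrA.
by rewrite rpredD // rpredM // natr_int.
Qed.

Lemma pintegralN p x : pintegral p x -> pintegral p (- x).
Proof. by move=> [a pa ax]; exists a => //; rewrite mulrN rpredN. Qed.

Lemma pintegralM p x y : pintegral p x -> pintegral p y -> pintegral p (x * y).
Proof.
move=> [a pa ax] [b pb bay]; exists (a * b)%N; first by rewrite coprimeMr pa.
by rewrite natrM mulrACA rpredM.
Qed.

Lemma pintegral_sum p (I : eqType) (r : seq I) (P : pred I) (f : I -> rat) :
  (forall i, i \in r -> P i -> pintegral p (f i)) ->
  pintegral p (\sum_(i <- r | P i) f i).
Proof.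
move=> pf; rewrite big_seq_cond; apply: big_ind.
- exact/pintegral_int/rpred0.
- exact: pintegralD.
- by move=> i /andP[]; exact: pf.
Qed.

Lemma pintegral_invn p n : (0 < n)%N -> coprime p n -> pintegral p n%:R^-1.
Proof. by move=> n0 pn; exists n; rewrite ?divff ?rpred1 // pnatr_eq0 -lt0n. Qed.

(** Clearing denominators gives [p %| b * n] with [b] coprime to [p], and Gauss's lemma removes
    [b]. *)
Lemma pintegral_divn p n : prime p -> pintegral p (n%:R / p%:R) -> (p %| n)%N.
Proof.
move=> pp [b pb /intrP[z bz]].
have p0 : p%:R != 0 :> rat by rewrite pnatr_eq0 -lt0n prime_gt0.
rewrite -(Gauss_dvdr _ pb); apply/dvdnP.
have zE : (z * p%:Z)%:~R = ((b * n)%:R : rat).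
  by rewrite intrM -bz natrM mulrA divfK.
have {}zE : z * p%:Z = (b * n)%N%:Z by apply: (@intr_inj rat); rewrite zE.
by exists `|z|%N; rewrite -[LHS]absz_nat -zE abszM.
Qed.

Lemma coprime_num_den_dvd p q : prime p ->
  ~~ ((p %| `|numq q|) && (p %| `|denq q|))%N.
Proof.
move=> pp; rewrite -dvdn_gcd (eqP (coprime_num_den q)) dvdn1.
by apply: contraTneq pp => ->.
Qed.

(** The reduced denominator is the witness: if [p] divided it, [p] would not divide the numerator
    and the valuation would be negative. *)
Lemma pintegral_val p q : prime p -> 0 <= padic_val p q -> pintegral p q.
Proof.
move=> pp; rewrite /padic_val subr_ge0 lez_nat => le_log.
exists `|denq q|%N.
  rewrite prime_coprime //; apply/negP => pd.
  have := coprime_num_den_dvd q pp; rewrite pd andbT => pn.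
  move: le_log; rewrite [logn p `|numq q|]lognE (negPf pn) !andbF leqNgt.
  by rewrite logn_gt0 mem_primes pp pd absz_gt0 denq_neq0.
rewrite mulrC -[q in q * _]divq_num_den.
by rewrite pmulrn absz_denq divfK ?intr_int // intr_eq0 denq_neq0.
Qed.

(** Here the absolute value of the reduced numerator is the witness. *)
Lemma pintegral_inv_val p q : prime p -> q != 0 -> padic_val p q = 0 ->
  pintegral p q^-1.
Proof.
move=> pp q0 v0.
have pd : ~~ (p %| `|numq q|)%N.
  apply/negP => pn.
  have := coprime_num_den_dvd q pp; rewrite pn /= => pd.
  move/eqP: v0; rewrite subr_eq0 eqz_nat [logn p `|denq q|]lognE (negPf pd) !andbF.
  by apply/negP; rewrite -lt0n logn_gt0 mem_primes pp pn absz_gt0 numq_eq0 q0.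
have nq0 : (numq q)%:~R != 0 :> rat by rewrite intr_eq0 numq_eq0.
exists `|numq q|%N; first by rewrite prime_coprime.
rewrite -[X in X^-1]divq_num_den invf_div mulrCA.
rewrite pmulrn abszE; case: (normrEsign (numq q)) => ->.
by rewrite intrM mulfK // rpredM ?intr_int.
Qed.

(** * The lifting monoid and its generators *)

Section Lifting.
Variables (M S : set rat) (phi : rat -> nat * set nat).
Hypotheses (hM : sparing_monoid M) (hphi : lifting_function M S phi).

Local Notation Mphi := (lifting_monoid M S phi).
Local Notation pi s := (phi s).1.
Local Notation N_ s := (phi s).2.

(** Elements of [M_s] are handled through their natural coefficients [n], which can be counted; [s]
    itself has coefficient [pi s]. *)
Definition scaled (s : rat) (n : nat) : rat := s / (pi s)%:R * n%:R.

(** For [s] in [S], this is the condition that [s] does not divide [scaled s n] in [M_s], read off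
    on coefficients. *)
Definition reduced (s : rat) (n : nat) : Prop :=
  N_ s n /\ forall m, N_ s m -> n <> (pi s + m)%N.

(* The canonical decomposition, with [x_s = (s / pi s) * n s]. *)
Definition coeff_decomposition (x x0 : rat) (n : rat -> nat) : Prop :=
  [/\ M x0, forall s, S s -> reduced s (n s),
      finite_set [set s | S s /\ n s != 0%N]
    & x = x0 + \sum_(s \in S) scaled s (n s)].

Let Msub : is_submonoid M := sparing_submonoid hM.

Lemma lifting_neq0 s : S s -> s != 0.
Proof. by move=> /(lifting_sub hphi)[]. Qed.

Lemma lifting_in s : S s -> M s.
Proof. by move=> /(lifting_sub hphi)[]. Qed.

Lemma lifting_pi_gt0 s : S s -> (0 < pi s)%N.
Proof. by move=> /(lifting_prime hphi)/prime_gt0. Qed.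

Lemma lifting_pi_neq0 s : S s -> (pi s)%:R != 0 :> rat.
Proof. by move=> Ss; rewrite pnatr_eq0 -lt0n lifting_pi_gt0. Qed.

Lemma scaledD s m n : scaled s (m + n) = scaled s m + scaled s n.
Proof. by rewrite /scaled natrD mulrDr. Qed.

Lemma scaled0 s : scaled s 0 = 0.
Proof. by rewrite /scaled mulr0. Qed.

Lemma scaled_mul_pi s k : S s -> scaled s (k * pi s) = s *+ k.
Proof.
by move=> Ss; rewrite /scaled natrM mulrCA divfK ?lifting_pi_neq0 // mulr_natl.
Qed.

Lemma scaled_inj s : S s -> injective (scaled s).
Proof.
move=> Ss m n /mulfI mn; apply/eqP; rewrite -(eqr_nat rat); apply/eqP/mn.
by rewrite mulf_neq0 ?invr_eq0 ?lifting_pi_neq0 ?lifting_neq0.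
Qed.

Lemma scaled_ge0 s n : M s -> 0 <= scaled s n.
Proof. by move=> /(sparing_ge0 hM) s0; rewrite !mulr_ge0 ?invr_ge0 ?ler0n. Qed.

Lemma lifting_componentE s : S s ->
  lifting_component S phi s = [set scaled s n | n in N_ s].
Proof. by move=> Ss; rewrite /lifting_component mem_set. Qed.

Lemma submonoid_mulrn q n : M q -> M (q *+ n).
Proof.
move=> Mq; elim: n => [|n IH]; first exact: Msub.1.
by rewrite mulrS; apply: Msub.2.
Qed.

Lemma submonoid_sum (H : set rat) (r : seq rat) (f : rat -> rat) :
  is_submonoid H -> (forall s, s \in r -> H (f s)) -> H (\sum_(s <- r) f s).
Proof.
move=> Hm Hf; rewrite big_seq; apply: (big_ind H) => //; [exact: Hm.1 | exact: Hm.2].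
Qed.

Lemma gen_submonoid_submonoid (T : nmodType) (A : set T) :
  is_submonoid (gen_submonoid A).
Proof.
split=> [H [[H0 _] _] // | x y Ax Ay H HA].
by have [[_ HD] _] := HA; apply: HD; [exact: Ax | exact: Ay].
Qed.

Lemma lifting_monoid_submonoid : is_submonoid Mphi.
Proof. exact: gen_submonoid_submonoid. Qed.

Lemma scaled_in_lifting s n : S s -> N_ s n -> Mphi (scaled s n).
Proof.
move=> Ss Nn; apply: sub_gen_smallest; exists s; first exact: lifting_in.
by rewrite lifting_componentE //; exists n.
Qed.

Lemma sub_lifting_monoid : M `<=` Mphi.
Proof.
move=> q Mq; case: (pselect (S q)) => [Sq | nSq].
  rewrite -[q]mulr1n -scaled_mul_pi // mul1n.
  by apply: scaled_in_lifting => //; exact: (lifting_mem hphi).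
apply: sub_gen_smallest; exists q => //; rewrite /lifting_component memNset //.
by exists 1%N; rewrite ?mulr1n.
Qed.

Lemma lifting_monoid_ge0 : Mphi `<=` [set q | 0 <= q].
Proof.
apply: smallest_sub.
  by split=> [|x y]; [exact: lexx | exact: addr_ge0].
move=> x [q Mq]; case: (pselect (S q)) => [Sq | nSq].
  by rewrite lifting_componentE // => -[n _ <-]; exact: scaled_ge0.
rewrite /lifting_component memNset // => -[n _ <-].
by rewrite /= mulrn_wge0 //; exact: sparing_ge0 hM _ _.
Qed.

(** * Canonical decompositions through coefficients, and their uniqueness *)

Lemma is_decomposition_coeff x x0 xs : is_decomposition M S phi x x0 xs ->
  exists n, coeff_decomposition x x0 n.
Proof.
move=> [Mx0 xsM xsN finxs ->].
have /choice[n nP] s : exists n, S s -> N_ s n /\ xs s = scaled s n.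
  case: (pselect (S s)) => [Ss|]; last by exists 0%N.
  by have := xsM s Ss; rewrite lifting_componentE // => -[n Nn <-]; exists n.
exists n; split=> //.
- move=> s Ss; have [Nn xsE] := nP s Ss; split=> // m Nm nE.
  apply: (xsN s Ss); exists (scaled s m).
    by rewrite lifting_componentE //; exists m.
  by rewrite xsE nE scaledD -[in scaled s (pi s)](mul1n (pi s)) scaled_mul_pi.
- apply: sub_finite_set finxs => s [Ss n0]; split=> //.
  apply: contra_neq n0 => xs0; apply: (scaled_inj Ss).
  by rewrite scaled0 -xs0; have [] := nP s Ss.
- by congr (_ + _); apply: eq_fsbigr => s; rewrite inE => /nP[].
Qed.

Lemma coeff_is_decomposition x x0 n : coeff_decomposition x x0 n ->
  is_decomposition M S phi x x0 (fun s => scaled s (n s)).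
Proof.
move=> [Mx0 redn finn ->]; split=> //.
- by move=> s Ss; rewrite lifting_componentE //; exists (n s) => //;
    have [] := redn s Ss.
- move=> s Ss; rewrite lifting_componentE // => -[_ [m Nm <-]] nE.
  have [_ /(_ m Nm)] := redn s Ss; apply; apply: (scaled_inj Ss).
  by rewrite nE scaledD -[in scaled s (pi s)](mul1n (pi s)) scaled_mul_pi.
- apply: sub_finite_set finn => s [Ss xs0]; split=> //.
  by apply: contra_neq xs0 => ->; rewrite scaled0.
Qed.

(* At the prime [pi t] every term but the [t]-th is integral, which determines
   [n t] modulo [pi t]; reducedness then leaves a single possibility. *)
Lemma coeff_decomposition_uniq x x0 y0 n m :
  coeff_decomposition x x0 n -> coeff_decomposition x y0 m ->
  x0 = y0 /\ forall s, S s -> n s = m s.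
Proof.
move=> [Mx0 redn finn xE] [My0 redm finm yE].
suff nm s : S s -> n s = m s.
  split=> //; move: xE; rewrite yE.
  have -> : \sum_(s \in S) scaled s (n s) = \sum_(s \in S) scaled s (m s).
    by apply: eq_fsbigr => s; rewrite inE => /nm->.
  by move/addIr.
(* By symmetry; the order makes the truncated [n s - m s] a true difference. *)
wlog le_mn : x0 y0 n m Mx0 redn finn xE My0 redm finm yE s / (m s <= n s)%N.
  move=> th Ss; case/orP: (leq_total (m s) (n s)) => le_s; last apply/esym.
    exact: (th x0 y0 n m).
  exact: (th y0 x0 m n).
move=> Ss.
have pp := lifting_prime hphi Ss.
(* [s] is included even if both coefficients vanish there, so that its term can be split off from
   the sum over [r]. *)
pose F := [set s] `|` ([set s | S s /\ n s != 0%N] `|` [set s | S s /\ m s != 0%N]).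
have finF : finite_set F by rewrite !finite_setU; split.
have FS : F `<=` S by move=> t [->|[[]|[]]].
have [r [uniqr rS Fr sumr]] := fsum_seq finF FS.
have vanish c : (forall t, S t -> ~ F t -> c t = 0%N) ->
    \sum_(t \in S) scaled t (c t) = \sum_(t <- r) scaled t (c t).
  by move=> c0; apply: sumr => t St Ft; rewrite c0 ?scaled0.
have eqF : x0 + \sum_(t <- r) scaled t (n t) = y0 + \sum_(t <- r) scaled t (m t).
  rewrite -!vanish -?xE // => t St Ft; apply/eqP; apply: contra_notT Ft => ?.
    by right; right.
  by right; left.
have sr : s \in r by apply: Fr; left.
have Mint q : M q -> pintegral (pi s) q.
  move=> Mq; have [->|q0] := eqVneq q 0; first exact/pintegral_int/rpred0.
  by apply: pintegral_val => //; apply: (lifting_val_ge0 hphi Ss).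
(* By injectivity of [pi], the denominators [pi t] with [t != s] are primes other than [pi s]. *)
have sum_int c : pintegral (pi s) (\sum_(t <- r | t != s) scaled t (c t)).
  apply: pintegral_sum => t tr ts; have St := rS t tr.
  apply: pintegralM; last exact/pintegral_int/natr_int.
  apply: pintegralM; first exact/Mint/lifting_in.
  apply: pintegral_invn; first exact: lifting_pi_gt0.
  rewrite prime_coprime // dvdn_prime2 //; last exact: lifting_prime hphi _ St.
  apply: contra_neqN ts => /eqP eqpi.
  by apply: (lifting_inj hphi); rewrite ?inE.
(* Solve [eqF] for the [s]-terms and divide by [s], whose inverse is integral at [pi s] since [s]
   has valuation 0 there. *)
have nm_int : pintegral (pi s) ((n s - m s)%:R / (pi s)%:R).
  have -> : (n s - m s)%:R / (pi s)%:R =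
      s^-1 * (y0 - x0 + \sum_(t <- r | t != s) scaled t (m t)
              - \sum_(t <- r | t != s) scaled t (n t)).
    move: eqF; rewrite !(bigD1_seq s) //=.
    set A := \sum_(t <- r | _) _; set B := \sum_(t <- r | _) _ => {}eqF.
    have -> : y0 - x0 + B - A = scaled s (n s) - scaled s (m s).
      apply: (addrI (x0 + A + scaled s (m s))).
      by transitivity (y0 + (scaled s (m s) + B)); [ring | rewrite -eqF; ring].
    by rewrite /scaled -mulrBr natrB // mulrA mulrA mulVf ?lifting_neq0 // mul1r mulrC.
  apply: pintegralM.
    by apply: pintegral_inv_val => //; [exact: lifting_neq0 | exact: (lifting_val_eq0 hphi)].
  apply: pintegralD; last exact/pintegralN/sum_int.
  by apply: pintegralD => //; apply: pintegralD; [|apply: pintegralN]; exact: Mint.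
(* Quotient 0 gives equality. Quotient [k.+1] would give [n s = pi s + (m s + k * pi s)] with the
   bracket in [N_ s], so [n s] would not be reduced. *)
have /dvdnP[[|k] nmE] := pintegral_divn pp nm_int.
  by apply/eqP; rewrite eqn_leq le_mn -subn_eq0 nmE andbT.
have [_ /(_ (m s + k * pi s)%N)] := redn s Ss; case.
  have Nsub := lifting_submonoid hphi Ss; apply Nsub.2; first by have [] := redm s Ss.
  elim: k {nmE} => [|k IH]; first exact: Nsub.1.
  by rewrite mulSn; apply Nsub.2 => //; exact: (lifting_mem hphi Ss).
by rewrite addnCA -mulSn -nmE subnKC.
Qed.

(** * Carrying, and existence of decompositions *)

(** Subtract [pi s] as long as the result stays in [N_ s]; this ends because [pi s] is positive. *)
Lemma reduced_exists s n : S s -> N_ s n ->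
  exists kc : nat * nat, n = (kc.1 * pi s + kc.2)%N /\ reduced s kc.2.
Proof.
move=> Ss; elim/ltn_ind: n => n IH Nn.
case: (pselect (reduced s n)) => [redn|]; first by exists (0%N, n).
move=> /not_andP[//|/existsNP[m /not_implyP[Nm /contrapT nE]]].
have [|[k c] /= [mE redc]] := IH m _ Nm.
  by rewrite nE -[ltnLHS]add0n ltn_add2r lifting_pi_gt0.
by exists (k.+1, c); split=> //=; rewrite nE mE mulSn addnA.
Qed.

(** Each block of [pi s] units in [n s] is worth one copy of [s], which is carried into the
    [M]-part; [k] counts these carries. *)
Lemma coeff_decomposition_exists x0 (n : rat -> nat) : M x0 ->
  (forall s, S s -> N_ s (n s)) -> finite_set [set s | S s /\ n s != 0%N] ->
  exists k c : rat -> nat,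
    [/\ forall s, S s -> n s = (k s * pi s + c s)%N, M (\sum_(s \in S) s *+ k s) &
      coeff_decomposition (x0 + \sum_(s \in S) scaled s (n s))
        (x0 + \sum_(s \in S) s *+ k s) c].
Proof.
move=> Mx0 Nn finn.
have /choice[kc kcP] s : exists kc : nat * nat, S s ->
    n s = (kc.1 * pi s + kc.2)%N /\ reduced s kc.2.
  case: (pselect (S s)) => [Ss|]; last by exists (0%N, 0%N).
  by have [kc] := reduced_exists Ss (Nn s Ss); exists kc.
pose k s := (kc s).1; pose c s := (kc s).2.
have nE s : S s -> n s = (k s * pi s + c s)%N by move=> /kcP[].
(* Carries and remainders are supported where [n] is, so all sums run over one finite list. *)
have n0 s : S s -> n s = 0%N -> k s = 0%N /\ c s = 0%N.
  move=> Ss; rewrite nE // => /eqP; rewrite addn_eq0 muln_eq0 => /andP[kp /eqP->].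
  by move: kp; rewrite -[pi s == _]negbK -lt0n lifting_pi_gt0 // orbF => /eqP.
have FS : [set s | S s /\ n s != 0%N] `<=` S by move=> s [].
have [r [uniqr rS Fr sumr]] := fsum_seq finn FS.
have supp s : S s -> ~ [set s | S s /\ n s != 0%N] s -> n s = 0%N.
  by move=> Ss nF; apply/eqP; apply: contra_notT nF.
have sumk : \sum_(s \in S) s *+ k s = \sum_(s <- r) s *+ k s.
  by apply: sumr => s Ss /supp-/(_ Ss)/n0-/(_ Ss)[-> _].
have Mk : M (\sum_(s \in S) s *+ k s).
  rewrite sumk; apply: submonoid_sum => // s /rS Ss.
  exact/submonoid_mulrn/lifting_in.
exists k, c; split=> //; split.
- exact: Msub.2.
- by move=> s /kcP[].
- apply: sub_finite_set finn => s [Ss cs]; split=> //.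
  by apply: contra_neq cs => /n0-/(_ Ss)[].
- rewrite -addrA; congr (_ + _); rewrite sumk !sumr.
  + rewrite -big_split /=; apply: eq_big_seq => s /rS Ss.
    by rewrite nE // scaledD scaled_mul_pi.
  + by move=> s Ss /supp-/(_ Ss)/n0-/(_ Ss)[_ ->]; rewrite scaled0.
  + by move=> s Ss /supp-> //; rewrite scaled0.
Qed.

(** The coefficients are added and then reduced. The carries [k] stay visible so that their
    vanishing can be exploited later. *)
Lemma coeff_decompositionD x x0 n y y0 m :
  coeff_decomposition x x0 n -> coeff_decomposition y y0 m ->
  exists k c : rat -> nat,
    [/\ forall s, S s -> (n s + m s = k s * pi s + c s)%N,
      M (\sum_(s \in S) s *+ k s) &
      coeff_decomposition (x + y) (x0 + y0 + \sum_(s \in S) s *+ k s) c].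
Proof.
move=> [Mx0 redn finn xE] [My0 redm finm yE].
pose F := [set s | S s /\ n s != 0%N] `|` [set s | S s /\ m s != 0%N].
have finF : finite_set F by rewrite finite_setU; split.
have FS : F `<=` S by move=> t [[]|[]].
have supp s : S s -> ~ F s -> n s = 0%N /\ m s = 0%N.
  by move=> Ss nF; split; apply/eqP; apply: contra_notT nF; [left | right].
have [r [uniqr rS Fr sumr]] := fsum_seq finF FS.
have [||| k [c [kcE Mk dec]]] := @coeff_decomposition_exists (x0 + y0) (fun s => n s + m s)%N.
- exact: Msub.2.
- move=> s Ss; have [Nn _] := redn s Ss; have [Nm _] := redm s Ss.
  by have [_] := lifting_submonoid hphi Ss; apply.
- apply: sub_finite_set finF => s [Ss]; rewrite addn_eq0 negb_and.
  by case/orP => ?; [left | right].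
exists k, c; split=> //; move: dec; congr coeff_decomposition.
have -> : \sum_(s \in S) scaled s (n s + m s) =
    \sum_(s \in S) scaled s (n s) + \sum_(s \in S) scaled s (m s).
  rewrite !sumr => [|s Ss /supp-/(_ Ss)[_ ->]|s Ss /supp-/(_ Ss)[-> _]|
      s Ss /supp-/(_ Ss)[-> ->]]; rewrite ?scaled0 //.
  by rewrite -big_split; apply: eq_bigr => s _; exact: scaledD.
by rewrite xE yE addrACA.
Qed.

Lemma coeff_decomposition0 x : M x -> coeff_decomposition x x (fun=> 0%N).
Proof.
move=> Mx; split=> //.
- move=> s Ss; split; first by have [] := lifting_submonoid hphi Ss.
  move=> m _ /eqP; rewrite eq_sym addn_eq0.
  by case: (pi s) (lifting_pi_gt0 Ss).
- by rewrite (_ : [set _ | _] = set0) //; apply/seteqP; split=> // s [].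
- by rewrite fsbig1 ?addr0 // => s _; exact: scaled0.
Qed.

(** The decomposable elements form a submonoid containing every generator. *)
Lemma lifting_monoid_decomposition x : Mphi x ->
  exists x0 n, coeff_decomposition x x0 n.
Proof.
suff sub : Mphi `<=` [set x | exists x0 n, coeff_decomposition x x0 n] by move/sub.
apply: smallest_sub.
  split=> [|{}x y [x0 [n xP]] [y0 [m yP]]].
    by exists 0, (fun=> 0%N); apply: coeff_decomposition0; exact: Msub.1.
  by have [k [c [_ _ xyP]]] := coeff_decompositionD xP yP; do 2 eexists; exact: xyP.
move=> {}x [q Mq]; case: (pselect (S q)) => [Sq | nSq]; last first.
  rewrite /lifting_component memNset // => -[n _ <-].
  exists (q *+ n), (fun=> 0%N); apply: coeff_decomposition0.
  exact: submonoid_mulrn.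
rewrite lifting_componentE // => -[n Nn <-].
(* The generator [scaled q n] need not be reduced, so this family concentrated at [q] is reduced
   with initial [M]-part 0. *)
pose m s := if s == q then n else 0%N.
have supp : [set s | S s /\ m s != 0%N] `<=` [set q].
  by move=> s [_] /=; rewrite /m; case: (s =P q).
have [|||k [c [_ _]]] := @coeff_decomposition_exists 0 m.
- exact: Msub.1.
- move=> s Ss; rewrite /m; case: eqP => [->//|_].
  by have [] := lifting_submonoid hphi Ss.
- exact: (sub_finite_set supp (finite_set1 q)).
rewrite add0r -(@fsbig_widen _ _ _ _ [set q]) => [|s ->//|s [_ /= sq]]; last first.
  by rewrite /m; case: eqP => // _; exact: scaled0.
by rewrite fsbig_set1 /m eqxx => dec; do 2 eexists; exact: dec.
Qed.

(** Existence of a decomposition ensures that [xget] returns a genuine first term and not its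
    default. *)
Lemma M_projectionP x : Mphi x ->
  exists n, coeff_decomposition x (M_projection M S phi x) n.
Proof.
move=> /lifting_monoid_decomposition[x0 [n dec]].
have [|xs xsP] := @xgetPex _ 0 [set y | exists xs, is_decomposition M S phi x y xs].
  by exists x0, (fun s => scaled s (n s)); exact: coeff_is_decomposition.
exact: is_decomposition_coeff xsP.
Qed.

(** * Divisibility under projection and transfer of the ACCP *)

Lemma coeff_decomposition_divides x x0 n : coeff_decomposition x x0 n ->
  divides_in Mphi x0 x.
Proof.
move=> [Mx0 redn finn ->]; exists (\sum_(s \in S) scaled s (n s)) => //.
have FS : [set s | S s /\ n s != 0%N] `<=` S by move=> t [].
have [r [uniqr rS Fr sumr]] := fsum_seq finn FS.
rewrite sumr => [|s Ss nF].
  apply: submonoid_sum; first exact: lifting_monoid_submonoid.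
  by move=> s /rS Ss; apply: scaled_in_lifting => //; have [] := redn s Ss.
rewrite (_ : n s = 0%N) ?scaled0 //.
by apply/eqP; apply: contra_notT nF.
Qed.

(* Along a divisibility chain the projections form a divisibility chain in [M];
   once they are constant no carry [s] can occur, so the coefficients of the two
   summands simply add up. *)
Lemma coeff_decomposition_step x x0 n y y0 m :
  coeff_decomposition x x0 n -> coeff_decomposition y y0 m ->
  divides_in Mphi y x ->
  divides_in M y0 x0 /\
  (x0 = y0 -> (\sum_(s \in S) (m s : nat) <= \sum_(s \in S) (n s : nat))%N /\
     (\sum_(s \in S) (n s : nat) = \sum_(s \in S) (m s : nat) -> x = y)).
Proof.
move=> xP yP [d /lifting_monoid_decomposition[d0 [l dP]] xE].
have [k [c [kcE Mk]]] := coeff_decompositionD yP dP.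
rewrite -xE => /(coeff_decomposition_uniq xP)[x0E nc].
have Md0 : M d0 by case: dP.
have d0_ge0 : 0 <= d0 := sparing_ge0 hM Md0.
have Mk_ge0 := sparing_ge0 hM Mk.
split; first by exists (d0 + \sum_(s \in S) s *+ k s); [exact: Msub.2 | rewrite addrA].
(* Cancelling [y0] leaves [d0] plus the total carry equal to 0; both are nonnegative, so both
   vanish. *)
move=> x0y0; move: x0E; rewrite x0y0 -addrA -[LHS]addr0 => /addrI/esym/eqP.
rewrite paddr_eq0 // => /andP[/eqP d00 /eqP sumk0].
case: dP => _ redl finl dE; case: yP => _ redm finm yE; case: xP => _ redn finn _.
pose F := [set s | S s /\ n s != 0%N] `|`
  ([set s | S s /\ m s != 0%N] `|` [set s | S s /\ l s != 0%N]).
have finF : finite_set F by rewrite !finite_setU; split.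
have FS : F `<=` S by move=> t [[]|[[]|[]]].
have [r [uniqr rS Fr sumr]] := fsum_seq finF FS.
have supp s : S s -> ~ F s -> [/\ n s = 0, m s = 0 & l s = 0]%N.
  move=> Ss nF; split; apply/eqP; apply: contra_notT nF => ?.
  - by left.
  - by right; left.
  - by right; right.
have kF s : S s -> ~ F s -> k s = 0%N.
  move=> Ss nFs; have [_ m0 l0] := supp s Ss nFs.
  move: (kcE s Ss) => /esym/eqP; rewrite m0 l0 !addn_eq0 muln_eq0 => /andP[+ _].
  by rewrite -[pi s == _]negbK -lt0n lifting_pi_gt0 // orbF => /eqP.
(* A vanishing sum of nonnegative terms [s *+ k s] with [s != 0] has every [k s] equal to 0. *)
have k0 s : S s -> k s = 0%N.
  move=> Ss; case: (pselect (F s)) => [/Fr sr | /kF-> //].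
  move: sumk0; rewrite sumr => [/eqP|t St /kF-/(_ St)-> //].
  rewrite big_seq psumr_eq0 => [|t /rS/lifting_in Mt]; last first.
    exact/mulrn_wge0/(sparing_ge0 hM).
  move=> /allP/(_ s sr); rewrite sr /= mulrn_eq0 (negPf (lifting_neq0 Ss)) orbF.
  by move/eqP.
have nE s : S s -> n s = (m s + l s)%N.
  by move=> Ss; rewrite nc // kcE // k0.
have -> : \sum_(s \in S) (n s : nat) =
    (\sum_(s \in S) (m s : nat) + \sum_(s \in S) (l s : nat))%N.
  rewrite !sumr => [|s Ss /supp-/(_ Ss)[]//|s Ss /supp-/(_ Ss)[]//|s Ss /supp-/(_ Ss)[]//].
  by rewrite -big_split; apply: eq_big_seq => s /rS; exact: nE.
split; first exact: leq_addr.
(* Equal coefficient sums force [l] to vanish on [S]; with [d0 = 0] the cofactor [d] is then 0. *)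
rewrite -[RHS]addn0 => /addnI.
rewrite sumr => [/eqP|s Ss /supp-/(_ Ss)[]//].
rewrite sum_nat_seq_eq0 => /allP l0.
rewrite xE dE d00 add0r fsbig1 ?addr0 // => s Ss.
suff -> : l s = 0%N by rewrite scaled0.
case: (pselect (F s)) => [/Fr/l0/eqP//|/supp-/(_ Ss)[]//].
Qed.

(** Forward, the ACCP passes from [x] to its divisor, the projection, and then down to [M].
    Backward, a chain stabilizes in two stages: first its projections, then its coefficient sums. *)
Lemma accp_lifting x : Mphi x ->
  satisfies_accp Mphi x <-> satisfies_accp M (M_projection M S phi x).
Proof.
move=> Px; have M_ge0 := sparing_ge0 hM.
have [n0 xP] := M_projectionP Px; have Mx0 : M (M_projection M S phi x) by case: xP.
split=> [accp |].
  apply: (satisfies_accp_sub Msub lifting_monoid_submonoid lifting_monoid_ge0) => //.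
    exact: sub_lifting_monoid.
  apply: (satisfies_accp_divisor lifting_monoid_submonoid lifting_monoid_ge0 Px) => //.
    exact: sub_lifting_monoid.
  exact: coeff_decomposition_divides xP.
move=> /(accpP Msub M_ge0 Mx0) accp.
apply/(accpP lifting_monoid_submonoid lifting_monoid_ge0 Px) => a a0 Pa diva.
have /choice[c cP] n := M_projectionP (Pa n).
have step n := coeff_decomposition_step (cP n) (cP n.+1) (diva n).
have [|||N stabN] := accp (fun n => M_projection M S phi (a n)).
- by rewrite a0.
- by move=> n; have [] := cP n.
- by move=> n; have [] := step n.
have projE n : (N <= n)%N -> M_projection M S phi (a n) = M_projection M S phi (a n.+1).
  by move=> Nn; rewrite (stabN n) ?(stabN n.+1) // ltnW.
have [|N' NN' stabN'] := @nonincreasing_nat_stabilizes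
    (fun n => \sum_(s \in S) (c n s : nat)) N.
  by move=> n Nn; have [_ /(_ (projE n Nn))[]] := step n.
(* From [N'] on, projections and coefficient sums are both constant, so consecutive terms agree. *)
exists N'; elim=> [|n IH]; first by rewrite leqn0 => /eqP->.
rewrite leq_eqVlt => /predU1P[->//|]; rewrite ltnS => N'n.
rewrite -IH //; have [_ /(_ (projE n (leq_trans NN' N'n)))[_ aE]] := step n.
by apply/esym/aE; rewrite !stabN' // ltnW.
Qed.

End Lifting.

Theorem proposition3p7 (M S : set rat) (phi : rat -> nat * set nat)
    (hM : sparing_monoid M) (hphi : lifting_function M S phi) :
  (forall x : rat, lifting_monoid M S phi x ->
     (satisfies_accp (lifting_monoid M S phi) x <->
      satisfies_accp M (M_projection M S phi x))) /\
  (monoid_accp (lifting_monoid M S phi) <-> monoid_accp M).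
Proof.
split=> [x|]; first exact: accp_lifting.
split=> accp b Hb.
  apply: (satisfies_accp_sub (sparing_submonoid hM) (lifting_monoid_submonoid M S phi)
    (lifting_monoid_ge0 hM) (sub_lifting_monoid hphi) Hb).
  by apply: accp; exact: (sub_lifting_monoid hphi).
(* It suffices that the projection of [b] lies in [M]. *)
apply/(accp_lifting hM hphi Hb)/accp.
by have [n []] := M_projectionP hM hphi Hb.
Qed.
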